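(* For every $n\ge1$, the number of fixed points $\mathrm{fix}$ is $1$-mesic under cyclic valley-hopping on $\mathfrak{S}_n$: for every cyclic valley-hopping orbit $\Pi'\subseteq\mathfrak{S}_n$, $\frac{1}{|\Pi'|}\sum_{\tau\in\Pi'}\mathrm{fix}(\tau)=1$.
   Context: Permutations are written in one-line notation with convention $\pi_0=\pi_{n+1}=\infty$. A letter $\pi_i$ is a peak if $\pi_{i-1}<\pi_i>\pi_{i+1}$, a valley if $\pi_{i-1}>\pi_i<\pi_{i+1}$, a double ascent if $\pi_{i-1}<\pi_i<\pi_{i+1}$, a double descent if $\pi_{i-1}>\pi_i>\pi_{i+1}$. Valley-hopping: for $x\in[n]$ write $\pi=w_1w_2xw_4w_5$ with $w_2$ (resp. $w_4$) the maximal consecutive subword immediately left (resp. right) of $x$ all of whose letters are smaller than $x$; $\varphi_x(\pi)=w_1w_4xw_2w_5$ if $x$ is a double ascent or double descent, and $\varphi_x(\pi)=\pi$ if $x$ is a peak or valley. These involutions commute. Canonical cycle representation: each cycle written with its largest element first, cycles in increasing order of their largest elements. Foata's fundamental transformation $o$ writes a permutation in canonical cycle representation and erases parentheses, giving a one-line permutation. Let $\psi_x=o^{-1}\circ\varphi_x\circ o$ and $\psi_S=\prod_{x\in S}\psi_x$ for $S\subseteq[n]$; the cyclic valley-hopping orbit of $\tau$ is $\{\psi_S(\tau):S\subseteq[n]\}$. $\mathrm{fix}(\tau)$ is the number of fixed points of $\tau$. A statistic is $c$-mesic under an action if its average over every orbit is $c$. *)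

(* Defs.v *)
From HB Require Import structures.
From mathcomp Require Import all_boot all_order all_algebra fingroup perm zify.

Set Implicit Arguments.
Unset Strict Implicit.
Unset Printing Implicit Defensive.

Local Open Scope nat_scope.

(* The letters 1, ..., n are represented by 'I_n, that is by 0, ..., n - 1, and
   every permutation, in one-line or in cycle notation, is an element of 'S_n. *)

Definition one_line n (s : 'S_n) : seq 'I_n := [seq s i | i <- enum 'I_n].

Lemma one_line_uniq n (s : 'S_n) : uniq (one_line s).
Proof. by rewrite map_inj_uniq ?enum_uniq //; apply: perm_inj. Qed.

Lemma size_one_line n (s : 'S_n) : size (one_line s) = n.
Proof. by rewrite size_map size_enum_ord. Qed.

Lemma mem_one_line n (s : 'S_n) x : x \in one_line s.
Proof. by rewrite -[x](permKV s) map_f ?mem_enum. Qed.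

(* The default value 1 is only reached when w is not a rearrangement of 'I_n;
   the words used below all are, by hop_perm and cycle_word_uniq. *)
Definition of_one_line n (w : seq 'I_n) : 'S_n :=
  insubd (1%g : 'S_n) [ffun i : 'I_n => nth i w i].

Lemma of_one_lineK n (w : seq 'I_n) :
  uniq w -> (forall x, x \in w) -> one_line (of_one_line w) = w.
Proof.
move=> Uw w_full.
have sz : size w = n.
  by rewrite -(card_uniqP Uw) -[RHS]card_ord; apply: eq_card => x; rewrite w_full.
have inj : injectiveb [ffun i : 'I_n => nth i w i].
  apply/injectiveP => i j; rewrite !ffunE => e; apply/val_inj/eqP.
  rewrite -(nth_uniq i _ _ Uw) ?sz; try exact: ltn_ord.
  by rewrite e (set_nth_default i) ?sz //; apply: ltn_ord.
have nthE (k : 'I_n) : of_one_line w k = nth k w k.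
  by rewrite /of_one_line /insubd insubT -pvalE /= ffunE.
case: (posnP n) => [n0 | n_gt0].
  by rewrite (size0nil (etrans sz n0)); apply: size0nil; rewrite size_one_line.
pose i0 : 'I_n := Ordinal n_gt0.
apply: (@eq_from_nth _ i0) => [|k]; rewrite size_one_line ?sz // => lt_in.
rewrite (nth_map i0) ?size_enum_ord // nthE nth_enum_ord //.
by rewrite (set_nth_default i0) ?sz.
Qed.

(* The i-th letter, i counted from 1; the value n plays the role of infinity in
   positions 0 and n + 1. *)
Definition letter n (s : 'S_n) (i : nat) : nat :=
  nth n (n :: [seq val y | y <- one_line s]) i.

Definition position n (s : 'S_n) (x : 'I_n) : nat := (index x (one_line s)).+1.

Definition double_ascent n (s : 'S_n) (x : 'I_n) : bool :=
  let i := position s x in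
  (letter s i.-1 < letter s i) && (letter s i < letter s i.+1).

Definition double_descent n (s : 'S_n) (x : 'I_n) : bool :=
  let i := position s x in
  (letter s i.-1 > letter s i) && (letter s i > letter s i.+1).

(* w1 w2 x w4 w5 |-> w1 w4 x w2 w5; the part of w on the left of x is read
   backwards, from x outwards, hence the reversals. *)
Definition hop n (x : 'I_n) (w : seq 'I_n) : seq 'I_n :=
  let l := rev (take (index x w) w) in
  let r := drop (index x w).+1 w in
  let k2 := find (fun y : 'I_n => ~~ (y < x)) l in
  let k4 := find (fun y : 'I_n => ~~ (y < x)) r in
  let w1 := rev (drop k2 l) in
  let w2 := rev (take k2 l) in
  let w4 := take k4 r in
  let w5 := drop k4 r in
  w1 ++ w4 ++ x :: w2 ++ w5.

Lemma hop_perm n (x : 'I_n) (w : seq 'I_n) : x \in w -> perm_eq (hop x w) w.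
Proof.
move=> xw; apply/seq.permP => p; rewrite /hop.
set l := rev (take _ w); set r := drop _.+1 w; set k2 := find _ l; set k4 := find _ r.
have -> : count p w = count p l + (p x + count p r).
  rewrite /l /r count_rev -{1}(cat_take_drop (index x w) w) count_cat.
  by rewrite (drop_nth x) ?index_mem //= nth_index.
have /(congr1 (count p)) := cat_take_drop k2 l; rewrite count_cat => <-.
have /(congr1 (count p)) := cat_take_drop k4 r; rewrite count_cat => <-.
rewrite !count_cat !count_rev /= !count_cat !count_rev.
lia.
Qed.

(* A letter that is neither a double ascent nor a double descent is a peak or a
   valley. *)
Definition valley_hop n (x : 'I_n) (s : 'S_n) : 'S_n :=
  if double_ascent s x || double_descent s x
  then of_one_line (hop x (one_line s)) else s.

Lemma one_line_valley_hop n (x : 'I_n) (s : 'S_n) :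
  one_line (valley_hop x s) =
  if double_ascent s x || double_descent s x
  then hop x (one_line s) else one_line s.
Proof.
rewrite /valley_hop; case: ifP => // _.
have hopP := hop_perm (mem_one_line s x).
apply: of_one_lineK; first by rewrite (perm_uniq hopP) one_line_uniq.
by move=> y; rewrite (perm_mem hopP) mem_one_line.
Qed.

(* orbit t m is the list m, t m, t (t m), ... of the letters of a cycle. *)
Definition cycle_leaders n (t : 'S_n) : seq 'I_n :=
  [seq m : 'I_n <- enum 'I_n | all (fun y : 'I_n => y <= m) (orbit t m)].

Definition canonical_cycles n (t : 'S_n) : seq (seq 'I_n) :=
  [seq orbit t m | m <- cycle_leaders t].

Definition cycle_word n (t : 'S_n) : seq 'I_n := flatten (canonical_cycles t).

Lemma orbit_permE n (t : 'S_n) m x : (x \in orbit t m) = (x \in porbit t m).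
Proof.
rewrite -fconnect_orbit; apply/idP/porbitP => [/iter_findex <- | [i ->]].
  by exists (findex t m x); rewrite permX.
by rewrite permX fconnect_iter.
Qed.

Lemma cycle_leader_eq n (t : 'S_n) m1 m2 x :
    m1 \in cycle_leaders t -> m2 \in cycle_leaders t ->
  x \in orbit t m1 -> x \in orbit t m2 -> m1 = m2.
Proof.
rewrite !mem_filter => /andP[/allP max1 _] /andP[/allP max2 _].
rewrite !orbit_permE -!eq_porbit_mem => /eqP e1 /eqP e2.
apply/val_inj/anti_leq/andP; split.
  by apply: max2; rewrite orbit_permE -e2 e1 porbit_id.
by apply: max1; rewrite orbit_permE -e1 e2 porbit_id.
Qed.

Lemma cycle_word_uniq n (t : 'S_n) : uniq (cycle_word t).
Proof.
have: {subset cycle_leaders t <= cycle_leaders t} by [].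
have: uniq (cycle_leaders t) by rewrite filter_uniq ?enum_uniq.
rewrite /cycle_word /canonical_cycles.
elim: {1 2 4}(cycle_leaders t) => //= m ms IHms /andP[m_ms Ums] sub.
rewrite cat_uniq orbit_uniq IHms // ?andbT => [|y y_ms]; last first.
  by rewrite sub ?inE ?y_ms ?orbT.
apply/hasPn => y /flatten_mapP[m' m'_ms y_m']; apply/negP => /= y_m.
suffices e : m = m' by rewrite e m'_ms in m_ms.
by apply: cycle_leader_eq y_m y_m'; rewrite sub ?inE ?eqxx ?m'_ms ?orbT.
Qed.

Lemma mem_cycle_word n (t : 'S_n) x : x \in cycle_word t.
Proof.
have x0 : x \in porbit t x by rewrite porbit_id.
case: (arg_maxnP (fun y : 'I_n => val y) x0) => m xm max_m.
have e : porbit t x = porbit t m by apply/eqP; rewrite eq_sym eq_porbit_mem.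
apply/flatten_mapP; exists m; last by rewrite orbit_permE -e.
rewrite mem_filter mem_enum andbT; apply/allP => y.
by rewrite orbit_permE -e => /max_m.
Qed.

Definition foata n (t : 'S_n) : 'S_n := of_one_line (cycle_word t).

Lemma one_line_foata n (t : 'S_n) : one_line (foata t) = cycle_word t.
Proof. exact: of_one_lineK (cycle_word_uniq t) (mem_cycle_word t). Qed.

Lemma cycle_leaderP n (t : 'S_n) m : m \in cycle_leaders t ->
  exists2 b, orbit t m = m :: b & all (fun y : 'I_n => y < m) b.
Proof.
rewrite mem_filter => /andP[/allP max_m _].
have e : orbit t m = m :: behead (orbit t m) by rewrite /orbit -orderSpred.
exists (behead (orbit t m)) => //; apply/allP => y y_m.
rewrite ltn_neqAle max_m ?andbT; last by rewrite e inE y_m orbT.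
apply: contraTneq y_m => /val_inj->.
by have:= orbit_uniq t m; rewrite {1}e /= => /andP[].
Qed.

Lemma cycle_leaders_sorted n (t : 'S_n) :
  sorted (fun x y : 'I_n => x < y) (cycle_leaders t).
Proof.
apply: sorted_filter => [y x z|]; first exact: ltn_trans.
by have:= iota_ltn_sorted 0 n; rewrite -val_enum_ord sorted_map.
Qed.

Lemma cycle_word_inj n (t u : 'S_n) :
  cycle_word t = cycle_word u -> canonical_cycles t = canonical_cycles u.
Proof.
rewrite /cycle_word /canonical_cycles.
have := @cycle_leaderP _ t; have := @cycle_leaderP _ u.
have := cycle_leaders_sorted t; have := cycle_leaders_sorted u.
elim: (cycle_leaders t) (cycle_leaders u) => [|m ms IHms] [|m' ms'] //=.
- by move=> _ _ /(_ m' (mem_head _ _))[b ->].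
- by move=> _ _ _ /(_ m (mem_head _ _))[b ->].
move=> sort' sort blocks' blocks.
have [b eb lt_b] := blocks m (mem_head _ _).
have [b' eb' lt_b'] := blocks' m' (mem_head _ _).
rewrite eb eb' /= => -[em e]; subst m'.
have find_size v c ls : all (fun y : 'I_n => y < m) c ->
    path (fun x y : 'I_n => x < y) m ls ->
    {in ls, forall k, exists2 d, orbit (v : 'S_n) k = k :: d & all (fun y : 'I_n => y < k) d} ->
  find (fun y : 'I_n => ~~ (y < m)) (c ++ flatten [seq orbit v k | k <- ls]) = size c.
- move=> lt_c path_ls blk; rewrite find_cat ifN; last first.
    by rewrite -all_predC; apply: sub_all lt_c => y /= ->.
  case: ls path_ls blk => [|k ls] /= ; first by rewrite addn0.
  case/andP=> lt_mk _ /(_ k (mem_head _ _))[d -> _] /=.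
  by rewrite -leqNgt ltnW ?addn0.
have sub k : k \in ms -> k \in m :: ms by rewrite inE orbC => ->.
have sub' k : k \in ms' -> k \in m :: ms' by rewrite inE orbC => ->.
have sz: size b = size b'.
  rewrite -(find_size t b ms) // => [|k /sub/blocks//].
  by rewrite e (find_size u b' ms') // => k /sub'/blocks'.
move/eqP: e; rewrite eqseq_cat // => /andP[/eqP-> /eqP e].
rewrite (IHms ms' (path_sorted sort') (path_sorted sort) _ _ e) // => k.
  by move=> /sub'/blocks'.
by move=> /sub/blocks.
Qed.

Lemma foata_inj n : injective (@foata n).
Proof.
move=> t u /(congr1 (@one_line n)); rewrite !one_line_foata => /cycle_word_inj e.
apply/permP => x; have /flatten_mapP[m m_t x_m] := mem_cycle_word t x.
have c_t: orbit t m \in canonical_cycles t by apply: map_f.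
have /mapP[m' _ e']: orbit t m \in canonical_cycles u by rewrite -e.
have Ct : fcycle t (orbit t m) by apply: cycle_orbit; apply: perm_inj.
have Cu : fcycle u (orbit t m) by rewrite e'; apply: cycle_orbit; apply: perm_inj.
by rewrite (eqP (next_cycle Ct x_m)) (eqP (next_cycle Cu x_m)).
Qed.

Definition cyclic_hop n (x : 'I_n) (t : 'S_n) : 'S_n :=
  invF (@foata_inj n) (valley_hop x (foata t)).

(* The maps cyclic_hop x commute, so the order of composition is immaterial. *)
Definition cyclic_hop_set n (S : {set 'I_n}) (t : 'S_n) : 'S_n :=
  foldr (@cyclic_hop n) t (enum S).

Definition cyclic_hop_orbit n (t : 'S_n) : {set 'S_n} :=
  [set cyclic_hop_set S t | S : {set 'I_n}].

Definition cyclic_hop_orbits n : {set {set 'S_n}} :=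
  [set cyclic_hop_orbit t | t : 'S_n].

Definition num_fixed_points n (t : 'S_n) : nat := #|[set i | t i == i]|.

Definition mesic (T : finType) (orbits : {set {set T}}) (f : T -> rat) (c : rat) : Prop :=
  forall O : {set T}, O \in orbits ->
    ((#|O|%:R)^-1 * \sum_(x in O) f x = c)%R.

(* Main.v *)
(* Let s be the word of t under Foata's transformation.  Then x is a fixed
   point of t iff x is a left-to-right maximum of s that is not followed by a
   smaller letter, and hopping x turns this condition into "x is the first
   letter of s".  As hopping x permutes each orbit, an orbit contains as many t
   with t x = x as t whose word starts with x; summing over x, each t of the
   orbit is counted once on the second side.

   That hopping x permutes the orbits holds because the hops are commuting
   involutions: on the decreasing binary tree of a word, hopping x exchanges
   the two subtrees of the node x when one of them is empty. *)
Require Import Defs.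
From mathcomp Require Import all_boot all_order all_algebra fingroup perm.
From mathcomp Require Import zify.

Set Implicit Arguments.
Unset Strict Implicit.
Unset Printing Implicit Defensive.

(** * Binary trees and flips at a node *)

Inductive tree (A : Type) := Leaf | Node of tree A & A & tree A.
Arguments Leaf {A}.

Fixpoint inorder A (T : tree A) : seq A :=
  if T is Node L y R then inorder L ++ y :: inorder R else [::].

Definition is_leaf A (T : tree A) := if T is Leaf then true else false.

Lemma nilp_inorder A (T : tree A) : nilp (inorder T) = is_leaf T.
Proof. by case: T => //= L y R; rewrite /nilp size_cat addnS. Qed.

(** In a decreasing tree, the nodes with two nonempty subtrees are the peaks of the word and those
    with none are its valleys, so only double ascents and double descents move. *)
Fixpoint flip (A : eqType) (x : A) (T : tree A) : tree A :=
  if T is Node L y R then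
    if y == x then if is_leaf L || is_leaf R then Node R y L else T
    else Node (flip x L) y (flip x R)
  else Leaf.

Lemma is_leaf_flip (A : eqType) (x : A) T : is_leaf (flip x T) = is_leaf T.
Proof. by case: T => //= L y R; do 2?case: ifP. Qed.

Lemma flipK (A : eqType) (x : A) : involutive (flip x).
Proof.
elim=> //= L IHL y R IHR.
have [->|/negPf yx] := eqVneq y x; last by rewrite /= yx IHL IHR.
by case leaf: (is_leaf L || is_leaf R); rewrite /= eqxx ?leaf // orbC leaf.
Qed.

(** A flip inside a subtree never changes whether that subtree is empty, so the test made at another
    node has the same outcome before and after it. *)
Lemma flipC (A : eqType) (x z : A) T : flip x (flip z T) = flip z (flip x T).
Proof.
elim: T => //= L IHL y R IHR.
have [<-|/negPf yz] := eqVneq y z; have [<-|/negPf yx] := eqVneq y x => //.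
- by rewrite /= eqxx !is_leaf_flip; case: ifP; rewrite /= yx.
- by rewrite /= eqxx !is_leaf_flip; case: ifP; rewrite /= yz.
- by rewrite /= yz yx IHL IHR.
Qed.

Lemma flip_notin (A : eqType) (x : A) T : x \notin inorder T -> flip x T = T.
Proof.
elim: T => //= L IHL y R IHR; rewrite mem_cat inE !negb_or.
by case/and3P=> xL xy xR; rewrite eq_sym (negPf xy) IHL ?IHR.
Qed.

Lemma perm_flip (A : eqType) (x : A) T : perm_eq (inorder (flip x T)) (inorder T).
Proof.
elim: T => //= L IHL y R IHR; case: ifP => _ /=; last by rewrite perm_cat ?perm_cons.
case: ifP => //= _; apply/seq.permP => p; rewrite !count_cat /=; lia.
Qed.

Section Words.

Variable n : nat.
Implicit Types (x y : 'I_n) (w : seq 'I_n) (T : tree 'I_n) (s t : 'S_n).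

(** * Decreasing trees of words *)

Definition below x : pred 'I_n := fun y => y < x.

Fixpoint heap T : bool :=
  if T is Node L y R then
    [&& all (below y) (inorder L), all (below y) (inorder R), heap L & heap R]
  else true.

Lemma heap_flip x T : heap T -> heap (flip x T).
Proof.
elim: T => //= L IHL y R IHR /and4P[lt_L lt_R heapL heapR].
case: ifP => _ /=; last by rewrite !(perm_all _ (perm_flip _ _)) lt_L lt_R IHL ?IHR.
by case: ifP => _ /=; rewrite lt_L lt_R heapL heapR.
Qed.

(** The new first letter descends the left spine past all larger letters; the tree it stops at
    becomes its right subtree. *)
Fixpoint tree_cons x T : tree 'I_n :=
  if T is Node L y R then
    if x < y then Node (tree_cons x L) y R else Node Leaf x T
  else Node Leaf x Leaf.

Lemma inorder_cons x T : inorder (tree_cons x T) = x :: inorder T.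
Proof. by elim: T => //= L IHL y R IHR; case: ifP => //= _; rewrite IHL. Qed.

Lemma heap_cons x T : x \notin inorder T -> heap T -> heap (tree_cons x T).
Proof.
elim: T => //= L IHL y R IHR; rewrite mem_cat inE !negb_or.
case/and3P=> xL xy xR /and4P[lt_L lt_R heapL heapR].
case: ltnP => [lt_xy | le_yx] /=.
  by rewrite inorder_cons /= {1}/below lt_xy lt_L lt_R heapR IHL.
have lt_yx : y < x by rewrite ltn_neqAle le_yx eq_sym val_eqE xy.
have lt_trans w : all (below y) w -> all (below x) w.
  by apply: sub_all => z lt_zy; apply: ltn_trans lt_yx.
by rewrite all_cat /= {2}/below lt_yx !lt_trans ?lt_L ?lt_R ?heapL.
Qed.

Definition word_tree w : tree 'I_n := foldr tree_cons Leaf w.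

Lemma word_treeK w : inorder (word_tree w) = w.
Proof. by elim: w => //= x w IHw; rewrite inorder_cons IHw. Qed.

Lemma heap_word_tree w : uniq w -> heap (word_tree w).
Proof. by elim: w => //= x w IHw /andP[xw /IHw]; apply: heap_cons; rewrite word_treeK. Qed.

(** * Hopping on a factored word and as a flip of its tree *)

(* w = w1 w2 x w4 w5 as in the definition of hopping; n plays the role of
   infinity at both ends of w. *)
Definition hop_split x w w1 w2 w4 w5 : Prop :=
  [/\ w = w1 ++ w2 ++ x :: w4 ++ w5,
      all (below x) w2, all (below x) w4,
      x < last n (map val w1) & x < head n (map val w5)].

(** Peaks have [w2] and [w4] both nonempty and stay put; for valleys both are empty and the exchange
    is the identity. *)
Definition hopped x w1 w2 w4 w5 : seq 'I_n :=
  if nilp w2 || nilp w4 then w1 ++ w4 ++ x :: w2 ++ w5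
  else w1 ++ w2 ++ x :: w4 ++ w5.

(** The subtrees of the node [x] spell [w2] and [w4], because the letters next to this block are
    ancestors of [x], hence larger. Each step up the tree extends [w5] or [w1]. *)
Lemma flip_hop_split x T :
    heap T -> uniq (inorder T) -> x \in inorder T ->
  exists w1 w2 w4 w5, hop_split x (inorder T) w1 w2 w4 w5 /\
    inorder (flip x T) = hopped x w1 w2 w4 w5.
Proof.
elim: T => //= L IHL y R IHR /and4P[lt_L lt_R heapL heapR].
rewrite cat_uniq /= mem_cat inE.
case/and4P=> uL; rewrite negb_or => /andP[yL LR] yR uR.
have [xL _ | xL /=] := boolP (x \in inorder L).
  have lt_xy : x < y := allP lt_L x xL.
  have xR : x \notin inorder R.
    by apply: contra LR => xR; apply/hasP; exists x.
  rewrite (flip_notin xR) (_ : y == x = false) /=; last first.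
    by apply: contraTF lt_xy => /eqP->; rewrite ltnn.
  have [w1 [w2 [w4 [w5 [[-> ? ? ? lt5] ->]]]]] := IHL heapL uL xL.
  exists w1, w2, w4, (w5 ++ y :: inorder R); split.
    split=> //; first by rewrite -!catA /= -!catA.
    (* If [w5] was empty, the block is now followed by the root [y], which exceeds [x]. *)
    by case: (w5) lt5.
  by rewrite /hopped; case: ifP => _; rewrite -!catA /= -!catA.
have [-> _ | neq_xy /= xR] := eqVneq x y.
  exists [::], (inorder L), (inorder R), [::].
  split; first by split; rewrite //= ?cats0.
  by rewrite /hopped !nilp_inorder; case: ifP; rewrite /= cats0.
have lt_xy : x < y := allP lt_R x xR.
rewrite (flip_notin xL) /=.
have [w1 [w2 [w4 [w5 [[-> ? ? lt1 ?] ->]]]]] := IHR heapR uR xR.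
exists (inorder L ++ y :: w1), w2, w4, w5; split.
  split=> //; first by rewrite -!catA /=.
  by rewrite map_cat last_cat /=; case: (w1) lt1.
by rewrite /hopped; case: ifP => _; rewrite -!catA /=.
Qed.

Lemma hop_split_exists s x :
  exists w1 w2 w4 w5, hop_split x (one_line s) w1 w2 w4 w5.
Proof.
have Us := one_line_uniq s; have xs := mem_one_line s x.
have := @flip_hop_split x (word_tree (one_line s)).
rewrite word_treeK heap_word_tree // => /(_ isT Us xs).
by move=> [w1 [w2 [w4 [w5 [? _]]]]]; exists w1, w2, w4, w5.
Qed.

Lemma hop_split_index x w w1 w2 w4 w5 : uniq w -> hop_split x w w1 w2 w4 w5 ->
  index x w = size (w1 ++ w2).
Proof.
move=> Uw [def_w _ _ _ _]; move: Uw; rewrite def_w catA cat_uniq /= negb_or.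
by case/and3P=> _ /andP[x12 _] _; rewrite index_cat (negPf x12) /= eqxx addn0.
Qed.

Lemma find_below_cat x u v :
    all (below x) u -> x < head n (map val v) ->
  find (fun y => ~~ (y < x)) (u ++ v) = size u.
Proof.
move=> lt_u lt_v; rewrite find_cat ifN; last first.
  by rewrite -all_predC; apply: sub_all lt_u => y lt_yx; apply/negPn.
by case: v lt_v => [|y v] /=; rewrite ?addn0 // -leqNgt => /ltnW->; rewrite addn0.
Qed.

Lemma hop_splitE x w w1 w2 w4 w5 : uniq w -> hop_split x w w1 w2 w4 w5 ->
  hop x w = w1 ++ w4 ++ x :: w2 ++ w5.
Proof.
move=> Uw spl; have eq_i := hop_split_index Uw spl.
have [def_w lt2 lt4 lt1 lt5] := spl.
rewrite /hop eq_i def_w (catA w1 w2) take_size_cat //.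
rewrite drop_cat ltnNge leqnSn subSn // subnn /= drop0 rev_cat.
rewrite !find_below_cat ?all_rev //; last first.
  by rewrite map_rev; case/lastP: (w1) lt1 => // u y; rewrite map_rcons rev_rcons last_rcons.
by rewrite !take_size_cat // !drop_size_cat ?size_rev // !revK.
Qed.

Lemma letter_splitE s x w1 w2 w4 w5 : hop_split x (one_line s) w1 w2 w4 w5 ->
  [/\ letter s (position s x).-1 = last n (map val (w1 ++ w2)),
      letter s (position s x) = x
    & letter s (position s x).+1 = head n (map val (w4 ++ w5))].
Proof.
move=> spl; have := hop_split_index (one_line_uniq s) spl.
rewrite /position /letter => ->; have [-> _ _ _ _] := spl.
rewrite catA map_cat; set u := w1 ++ w2; split => /=.
(* The leading sentinel shifts indices by one: the predecessor of [x] is the last entry of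
   [n :: map val u]. *)
- rewrite -cat_cons nth_cat /= size_map ltnSn.
  by rewrite -[RHS]nth_last /= ?size_map; case: (u).
- by rewrite nth_cat size_map ltnn subnn.
by rewrite nth_cat size_map ltnNge leqnSn /= subSn // subnn /= nth0.
Qed.

(** The left neighbour of [x] is smaller iff [w2] is nonempty, the right one iff [w4] is. *)
Lemma double_letterE s x w1 w2 w4 w5 : hop_split x (one_line s) w1 w2 w4 w5 ->
  double_ascent s x || double_descent s x = (nilp w2 (+) nilp w4).
Proof.
move=> spl; rewrite /double_ascent /double_descent.
have [-> -> ->] := letter_splitE spl; have [_ lt2 lt4 lt1 lt5] := spl.
have ->: (last n (map val (w1 ++ w2)) < x) = ~~ nilp w2.
  rewrite map_cat last_cat; case/lastP: w2 lt2 {spl} => [|w2 z] /=.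
    by rewrite ltnNge (ltnW lt1).
  by rewrite all_rcons map_rcons last_rcons /nilp size_rcons => /andP[].
have ->: (x < last n (map val (w1 ++ w2))) = nilp w2.
  rewrite map_cat last_cat; case/lastP: w2 lt2 {spl} => [|w2 z] /=.
    by rewrite lt1.
  rewrite all_rcons map_rcons last_rcons /nilp size_rcons => /andP[lt_z _].
  by rewrite ltnNge (ltnW lt_z).
have ->: (head n (map val (w4 ++ w5)) < x) = ~~ nilp w4.
  case: w4 lt4 {spl} => [|z w4] /=; first by rewrite ltnNge (ltnW lt5).
  by case/andP.
have ->: (x < head n (map val (w4 ++ w5))) = nilp w4.
  case: w4 lt4 {spl} => [|z w4] /=; first by rewrite lt5.
  by case/andP=> lt_z _; rewrite ltnNge (ltnW lt_z).
by case: (nilp w2); case: (nilp w4).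
Qed.

Lemma valley_hop_splitE s x w1 w2 w4 w5 : hop_split x (one_line s) w1 w2 w4 w5 ->
  one_line (valley_hop x s) = hopped x w1 w2 w4 w5.
Proof.
move=> spl; rewrite one_line_valley_hop (double_letterE spl).
rewrite (hop_splitE (one_line_uniq s) spl) /hopped.
have [-> _ _ _ _] := spl.
by case: (w2) => [|? ?]; case: (w4).
Qed.

Lemma valley_hop_flip s x T : heap T -> one_line s = inorder T ->
  one_line (valley_hop x s) = inorder (flip x T).
Proof.
move=> heapT def_s; have := one_line_uniq s; have := mem_one_line s x.
rewrite def_s => xT UT.
have [w1 [w2 [w4 [w5 [spl ->]]]]] := flip_hop_split heapT UT xT.
by apply: valley_hop_splitE; rewrite def_s.
Qed.

Lemma one_line_inj : injective (@one_line n).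
Proof.
move=> s t /eq_in_map e; apply/permP => i.
by apply: e; rewrite mem_enum.
Qed.

Lemma index_one_line s i : index (s i) (one_line s) = i.
Proof. by rewrite index_map ?index_enum_ord //; apply: perm_inj. Qed.

Lemma one_line_heap s : exists2 T, heap T & one_line s = inorder T.
Proof.
exists (word_tree (one_line s)); last by rewrite word_treeK.
exact/heap_word_tree/one_line_uniq.
Qed.

(** * Commuting involutions and stability of orbits *)

Lemma valley_hopC x y s :
  valley_hop x (valley_hop y s) = valley_hop y (valley_hop x s).
Proof.
have [T heapT def_s] := one_line_heap s; apply: one_line_inj.
have hop1 z := valley_hop_flip z heapT def_s.
by rewrite !(valley_hop_flip _ (heap_flip _ heapT) (hop1 _)) flipC.
Qed.

Lemma valley_hopK x : involutive (@valley_hop n x).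
Proof.
move=> s; have [T heapT def_s] := one_line_heap s; apply: one_line_inj.
have hop1 := valley_hop_flip x heapT def_s.
by rewrite (valley_hop_flip _ (heap_flip _ heapT) hop1) flipK.
Qed.

Lemma foata_cyclic_hop x t : foata (cyclic_hop x t) = valley_hop x (foata t).
Proof. exact: f_invF. Qed.

Lemma cyclic_hopC x y t :
  cyclic_hop x (cyclic_hop y t) = cyclic_hop y (cyclic_hop x t).
Proof. by apply: foata_inj; rewrite !foata_cyclic_hop valley_hopC. Qed.

Lemma cyclic_hopK x : involutive (@cyclic_hop n x).
Proof. by move=> t; apply: foata_inj; rewrite !foata_cyclic_hop valley_hopK. Qed.

Lemma cyclic_hop_setD1 (S : {set 'I_n}) x t : x \in S ->
  cyclic_hop_set S t = cyclic_hop x (cyclic_hop_set (S :\ x) t).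
Proof.
move=> xS; rewrite /cyclic_hop_set.
have ->: enum (S :\ x) = rem x (enum S).
  rewrite rem_filter ?enum_uniq // -filter_predI.
  by apply: eq_filter => y; rewrite !inE.
have: x \in enum S by rewrite mem_enum.
elim: (enum S) => //= y w IHw; rewrite inE eq_sym.
by case: eqVneq => [-> // | _ /= /IHw ->]; rewrite cyclic_hopC.
Qed.

(** Hopping [x] after the hops of [S] amounts to adding [x] to [S] or removing it. *)
Lemma cyclic_hop_orbit_stable x t u :
  (cyclic_hop x u \in cyclic_hop_orbit t) = (u \in cyclic_hop_orbit t).
Proof.
have hop_in v : v \in cyclic_hop_orbit t -> cyclic_hop x v \in cyclic_hop_orbit t.
  case/imsetP=> S _ ->; have [xS | xS] := boolP (x \in S).
    by rewrite (cyclic_hop_setD1 _ xS) cyclic_hopK; apply: imset_f.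
  by rewrite -{1}(setU1K xS) -cyclic_hop_setD1 ?setU11 //; apply: imset_f.
by apply/idP/idP => /hop_in; rewrite ?cyclic_hopK.
Qed.

(** * Fixed points as isolated letters *)

(* x is a left-to-right maximum of w that is not followed by a smaller letter,
   that is, (x) is a cycle of the permutation encoded by w. *)
Definition isolated x w : bool :=
  all (below x) (take (index x w) w) &&
  (x < head n (map val (drop (index x w).+1 w))).

Lemma isolated_cat x u v : x \notin u ->
  isolated x (u ++ x :: v) = all (below x) u && (x < head n (map val v)).
Proof.
move=> xu; rewrite /isolated index_cat (negPf xu) /= eqxx addn0.
by rewrite take_size_cat // -cat_rcons drop_size_cat ?size_rcons.
Qed.

(** After an exchange, [x] is isolated iff [w1] and the new right block [w2] are empty, that is, iff
    nothing preceded [x] originally. For a peak both sides fail, as [w2] and [w4] are nonempty. *)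
Lemma isolated_valley_hop s x :
  isolated x (one_line (valley_hop x s)) = (index x (one_line s) == 0).
Proof.
have [w1 [w2 [w4 [w5 spl]]]] := hop_split_exists s x.
rewrite (hop_split_index (one_line_uniq s) spl) (valley_hop_splitE spl).
have [_ lt2 lt4 lt1 lt5] := spl.
have isolated_split u v : x \notin w1 ++ u -> all (below x) u -> all (below x) v ->
  isolated x ((w1 ++ u) ++ x :: v ++ w5) = nilp w1 && nilp v.
- move=> xu lt_u lt_v; rewrite isolated_cat // all_cat lt_u andbT; congr andb.
    case/lastP: w1 lt1 {spl xu} => [|w1 z] //.
    rewrite map_rcons last_rcons all_rcons /nilp size_rcons /below => lt_xz.
    by rewrite ltnNge (ltnW lt_xz).
  case: v lt_v => [|z v] /=; first by rewrite lt5.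
  by case/andP=> lt_z _; rewrite ltnNge (ltnW lt_z).
have := one_line_uniq (valley_hop x s); rewrite (valley_hop_splitE spl) /hopped.
rewrite size_cat addn_eq0.
case: ifP => nil24; rewrite catA cat_uniq /= negb_or => /and3P[_ /andP[xu _] _].
  by rewrite isolated_split.
by rewrite isolated_split //; case: (w2) nil24 => // ? ?; case: (w4).
Qed.

Lemma orbit_fixed t x y : t x = x -> y \in orbit t x -> y = x.
Proof. by move=> tx; rewrite -fconnect_orbit => /iter_findex <-; apply: iter_fix. Qed.

Lemma orbit_sym t x y : (y \in orbit t x) = (x \in orbit t y).
Proof. by rewrite !orbit_permE porbit_sym. Qed.

(** A leader exceeds all letters of earlier cycles and is exceeded by the next leader, so it is
    isolated iff its cycle has no other letter. Any other letter comes after its larger leader. *)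
Lemma fixed_point_isolated t x : (t x == x) = isolated x (cycle_word t).
Proof.
have /flatten_mapP[m m_t x_m] := mem_cycle_word t x.
have leadP := @cycle_leaderP n t.
have [b def_m lt_b] := leadP m m_t.
have := cycle_leaders_sorted t; have := cycle_word_uniq t.
rewrite /cycle_word /canonical_cycles.
case/splitPr: m_t leadP => l1 l2 leadP.
rewrite map_cat flatten_cat /= def_m /=; set u := flatten _; set v := flatten _.
rewrite cat_uniq /= negb_or => /and3P[_ /andP[m_u bv_u] /andP[m_bv _]].
rewrite sorted_pairwise; last by move=> y z k; apply: ltn_trans.
rewrite pairwise_cat /= => /and3P[l1_m _ /andP[m_l2 _]].
have lt_u : all (below m) u.
  apply/allP => y /flatten_mapP[k k_l1]; have lt_km : k < m.
    by move/allrelP: l1_m; apply; rewrite ?mem_head.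
  have [|d -> lt_d] := leadP k; first by rewrite mem_cat k_l1.
  by rewrite inE => /predU1P[-> // | /(allP lt_d) lt_yk]; apply: ltn_trans lt_km.
have lt_v : m < head n (map val v).
  rewrite /v; case: l2 leadP m_l2 {m_bv bv_u v l1_m} => //= k l2 leadP /andP[lt_mk _].
  by have [|d -> _] := leadP k; rewrite // mem_cat !inE eqxx !orbT.
have [-> | neq_xm] := eqVneq x m.
  rewrite isolated_cat // lt_u /=; apply/eqP/idP => [tm | lt_m].
    case: b def_m lt_b {m_bv bv_u} => //= y b def_m /andP[lt_ym _].
    have /(orbit_fixed tm) eq_ym : y \in orbit t m by rewrite def_m !inE eqxx orbT.
    by rewrite eq_ym /below ltnn in lt_ym.
  have: t m \in orbit t m by rewrite -fconnect_orbit fconnect1.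
  rewrite def_m; case: b lt_m lt_b {def_m m_bv bv_u} => [|y b] /=.
    by rewrite inE => _ _ /eqP.
  by move=> lt_my /andP[lt_ym _]; have:= ltn_trans lt_my lt_ym; rewrite ltnn.
have [tx | _] := eqP.
  by case/eqP: neq_xm; apply/esym/(orbit_fixed tx); rewrite orbit_sym.
have x_b : x \in b by move: x_m; rewrite def_m inE (negPf neq_xm).
have lt_xm : x < m := allP lt_b x x_b.
(* Isolation would put the leader [m], which precedes [x], below [x]. *)
apply/esym/negP => /andP[/allP lt_pre _]; have: below x m.
  have x_u : x \notin u by apply: (hasPn bv_u); rewrite mem_cat x_b.
  apply: lt_pre; rewrite index_cat (negPf x_u) /= eq_sym (negPf neq_xm) take_cat ltnNge leq_addr /= addKn.
  by rewrite mem_cat mem_head orbT.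
by rewrite /below ltnNge (ltnW lt_xm).
Qed.

Lemma fixed_point_cyclic_hop t x :
  (cyclic_hop x t x == x) = (index x (one_line (foata t)) == 0).
Proof.
by rewrite fixed_point_isolated -one_line_foata foata_cyclic_hop isolated_valley_hop.
Qed.

(** * Double counting over an orbit *)

Lemma sum_fixed_points_orbit t : 0 < n ->
  \sum_(u in cyclic_hop_orbit t) num_fixed_points u = #|cyclic_hop_orbit t|.
Proof.
move=> n_gt0; set O := cyclic_hop_orbit t.
have sumE : \sum_(u in O) num_fixed_points u = \sum_(u in O) \sum_x (u x == x : nat).
  apply: eq_bigr => u _; rewrite /num_fixed_points -sum1_card big_mkcond.
  by apply: eq_bigr => x _; rewrite inE; case: eqP.
have first_letter u : \sum_x (index x (one_line (u : 'S_n)) == 0 : nat) = 1.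
  (* Here [u] is read as a one-line word, nonempty as [0 < n], with first letter [x0]. *)
  pose x0 := u (Ordinal n_gt0).
  have eq0 x : (index x (one_line u) == 0) = (x == x0).
    rewrite -(permKV u x) index_one_line (inj_eq perm_inj).
    by rewrite -val_eqE.
  by rewrite (bigD1 x0) //= eq0 eqxx big1 // => x; rewrite eq0 => /negPf->.
rewrite sumE exchange_big /= -sum1_card.
transitivity (\sum_x \sum_(u in O) (index x (one_line (foata u)) == 0 : nat)).
  (* For each fixed [x], the orbit is reindexed by its own bijection [cyclic_hop x]. *)
  apply: eq_bigr => x _; rewrite (reindex_inj (inv_inj (cyclic_hopK x))).
  by apply: eq_big => u; rewrite ?cyclic_hop_orbit_stable ?fixed_point_cyclic_hop.
by rewrite exchange_big; apply: eq_bigr => u _; apply: first_letter.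
Qed.

End Words.

Theorem theorem26 (n : nat) (hn : (1 <= n)%N) :
  mesic (cyclic_hop_orbits n) (fun t : 'S_n => (num_fixed_points t)%:R%R) 1%R.
Proof.
move=> O /imsetP[t _ ->]; rewrite -GRing.natr_sum sum_fixed_points_orbit //.
(* The orbit is nonempty, so its size is invertible in [rat]. *)
apply: GRing.mulVf; rewrite Num.Theory.pnatr_eq0 -lt0n; apply/card_gt0P.
by exists (cyclic_hop_set set0 t); apply: imset_f.
Qed.
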